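(* Let $\mathbf F=\{\mathcal F_a\mid a\in A\}$, where each $\mathcal F_a$ is a family of filters over some set $I_a$. (1) There is $\mathbf Q=\{\mathcal Q_b\mid b\in B\}$, where each $\mathcal Q_b$ is a family of filters over some set $J_b$, such that $\mathfrak F(\mathbf Fc)=\mathbf Qc$. (2) More generally, for every class $\mathcal H$ of topological spaces, there is $\mathbf Q=\{\mathcal Q_b\mid b\in B\}$, where each $\mathcal Q_b$ is a family of filters over some set $J_b$, such that $(\mathbf Fc:\mathcal H)=\mathbf Qc$.
   Context: No separation axioms are assumed. Filters are allowed to be improper (the power set $P(I)$ counts as a filter over $I$). For a filter $F$ over a set $I$, a sequence $(x_i)_{i\in I}$ of elements of a topological space $X$ is said to $F$-converge to $x\in X$ if $\{i\in I \mid x_i\in U\}\in F$ for every neighborhood $U$ of $x$ in $X$; it $F$-converges in $X$ if it $F$-converges to some $x \in X$. For a family $\mathcal F$ of filters over $I$, a topological space $X$ is sequencewise $\mathcal F$-compact if for every sequence $(x_i)_{i\in I}$ of elements of $X$ there is $F\in\mathcal F$ such that $(x_i)_{i\in I}$ $F$-converges in $X$. If $\mathbf F=\{\mathcal F_a\mid a\in A\}$, where each $\mathcal F_a$ is a family of filters over some set $I_a$, a topological space $X$ is $\mathbf F$-compact if $X$ is sequencewise $\mathcal F_a$-compact for every $a\in A$. The class of all $\mathbf F$-compact spaces is denoted by $\mathbf Fc$ (and likewise $\mathbf Qc$ for $\mathbf Q$). For classes $\mathcal K,\mathcal H$ of topological spaces, $(\mathcal K:\mathcal H)$ is the class of all topological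 spaces $X$ such that $X\times Y\in\mathcal K$ whenever $Y\in\mathcal H$ (product topology), and $\mathfrak F(\mathcal K)=(\mathcal K:\mathcal K)$. *)

(* Defs.v *)
From mathcomp Require Import all_boot all_classical.
From mathcomp Require Import topology.

Set Implicit Arguments.
Unset Strict Implicit.
Unset Printing Implicit Defensive.

Local Open Scope classical_set_scope.

(* The universe of the carriers of topological spaces. Sharing it with the
   index types keeps the index of a family of families of filters a set: it
   cannot be as large as the class of all topological spaces. *)
Notation small := (Type@{Topological.axioms_.u0}) (only parsing).

(* [set topologicalType] is ruled out by universe constraints, hence the plain
   predicate; two classes are equal when they have the same members. *)
Definition space_class := topologicalType -> Prop.

Definition class_eq (K H : space_class) : Prop := forall X, K X <-> H X.

(* [filter_on I] is the type of all filters over [I], including the improper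
   filter [setT]. *)
Definition seqwise_compact (I : small) (F : set (filter_on I))
    (X : topologicalType) : Prop :=
  forall x : I -> X,
    exists2 G : filter_on I, F G & exists p : X, x @ G --> p.

Definition compact_class (A : small) (I : A -> small)
    (F : forall a : A, set (filter_on (I a))) : space_class :=
  fun X => forall a, seqwise_compact (F a) X.

Definition residual (K H : space_class) : space_class :=
  fun X => forall Y : topologicalType, H Y -> K (X * Y)%type.

Definition productive (K : space_class) : space_class := residual K K.

(* Main.v *)
Require Import Defs.
From mathcomp Require Import all_boot all_classical.
From mathcomp Require Import topology.

(** Convergence along a filter in a product is coordinatewise.  Hence [X * Y] is
    sequencewise [F a]-compact exactly when, for each sequence [y] in [Y], the
    space [X] is sequencewise compact for the subfamily of those filters of
    [F a] along which [y] converges ([seqwise_compact_prodP]).  Letting [Y] run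
    over [H], membership of [X] in the residual class becomes compactness for
    all the subfamilies obtained in this way.

    The sequences [y] in members of [H] form a proper class, so they cannot
    index these subfamilies.  The subfamilies themselves can: for each [a] they
    are subsets of one fixed set, that of the filters over [I a], so they can
    index themselves.  Finally, the productive class is the residual of the
    class with respect to itself. *)

Set Implicit Arguments.
Unset Strict Implicit.
Unset Printing Implicit Defensive.

Local Open Scope classical_set_scope.

Lemma cvg_prodP (I : Type) (G : filter_on I) (X Y : topologicalType)
    (x : I -> X) (y : I -> Y) (p : X * Y) :
  (x i, y i) @[i --> G] --> p <-> x @ G --> p.1 /\ y @ G --> p.2.
Proof.
case: p => p q; split=> [cxy | [cx cy]]; last exact: cvg_pair.
split.
- exact: cvg_comp cxy cvg_fst.
- exact: cvg_comp cxy cvg_snd.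
Qed.

Definition converging_filters (I : Type) (F : set (filter_on I))
    (Y : topologicalType) (y : I -> Y) : set (filter_on I) :=
  [set G : filter_on I | F G /\ exists q : Y, y @ G --> q].

Lemma seqwise_compact_prodP (I : small) (F : set (filter_on I))
    (X Y : topologicalType) :
  seqwise_compact F (X * Y)%type <->
  forall y : I -> Y, seqwise_compact (converging_filters F y) X.
Proof.
split=> [cXY y x | cX z].
- have [G FG [p /cvg_prodP [cx cy]]] := cXY (fun i => (x i, y i)).
  by exists G; [split=> //; exists p.2 | exists p.1].
- have [G [FG [q cy]] [p cx]] := cX (snd \o z) (fst \o z).
  exists G => //; exists (p, q).
  have -> : z = (fun i => ((fst \o z) i, (snd \o z) i)).
    by apply/funext => i /=; case: (z i).
  exact/cvg_prodP.
Qed.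

(** The index type collects the subfamilies that sequences in members of [H]
    determine, not the sequences; the quantifiers over [H] occur only inside a
    proposition and so do not raise its universe. *)
Lemma residual_compact_class (A : small) (I : A -> small)
    (F : forall a : A, set (filter_on (I a))) (H : space_class) :
  exists (B : small) (J : B -> small)
    (Q : forall b : B, set (filter_on (J b))),
    class_eq (residual (compact_class F) H) (compact_class Q).
Proof.
pose trace a (S : set (filter_on (I a))) :=
  exists (Y : topologicalType) (y : I a -> Y),
    H Y /\ S = converging_filters (F a) y.
pose B := {a : A & {S : set (filter_on (I a)) | trace a S}}.
exists B, (fun b => I (projT1 b)).
exists (fun b : B => proj1_sig (projT2 b)) => X.
split=> [rX [a [S [Y [y [HY Sy]]]]] | cX Y HY a].
- by rewrite /= Sy; apply: (seqwise_compact_prodP _ _ _).1 => //; exact: rX.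
- apply/seqwise_compact_prodP => y.
  have trace_y : trace a (converging_filters (F a) y) by exists Y, y.
  exact: (cX (existT _ a (exist _ _ trace_y))).
Qed.

Theorem theorem4 (A : small) (I : A -> small)
    (F : forall a : A, set (filter_on (I a))) :
  (exists (B : small) (J : B -> small)
      (Q : forall b : B, set (filter_on (J b))),
      class_eq (productive (compact_class F)) (compact_class Q)) /\
  (forall H : space_class,
    exists (B : small) (J : B -> small)
      (Q : forall b : B, set (filter_on (J b))),
      class_eq (residual (compact_class F) H) (compact_class Q)).
Proof.
split=> [|H]; exact: residual_compact_class.
Qed.
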